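(* Let $p$ be a prime, and let $d$ and $t$ be positive integers. Assume that $x_1^{k_1}x_2^{k_2}\cdots x_{p^t}^{k_{p^t}}$ is the cycle type of a complete mapping of the additive group $\mathbb{F}_p^t$. For $\ell=1,2,\ldots,p^t$ and $i=1,2,\ldots,k_{\ell}$, let $\gamma_{\ell,i}\in\Gamma(d,p,\ell)$. Then for every $d$-dimensional $\mathbb{F}_p$-subspace $W$ of $\mathbb{F}_p^{d+t}$, the $\mathbb{F}_p$-vector space $\mathbb{F}_p^{d+t}$ admits a $W$-coset-wise $\mathbb{F}_p$-affine complete mapping whose cycle type is \[ \prod_{\ell=1}^{p^t}\prod_{i=1}^{k_{\ell}}\operatorname{BU}_{\ell}(\gamma_{\ell,i}). \]
   Context: A complete mapping of an additive group $G$ is a permutation $f$ of $G$ such that $x\mapsto f(x)+x$ is also a permutation of $G$. The cycle type $\operatorname{CT}(\sigma)$ of a permutation $\sigma$ of a finite set $\Omega$ is the monomial $x_1^{k_1}x_2^{k_2}\cdots x_{|\Omega|}^{k_{|\Omega|}}\in\mathbb{Q}[x_n:n\geq1]$, where $k_\ell$ is the number of cycles of length $\ell$ of $\sigma$; for a set $X$ of permutations, $\operatorname{CT}(X)=\{\operatorname{CT}(\sigma):\sigma\in X\}$. For a positive integer $\ell$, $\operatorname{BU}_\ell$ is the unique $\mathbb{Q}$-algebra endomorphism of $\mathbb{Q}[x_n:n\geq1]$ with $\operatorname{BU}_\ell(x_n)=x_{\ell n}$ for all $n\geq1$. Vectors in $\mathbb{F}_p^d$ are row vectors. For a $(d\times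 d)$-matrix $M$ over $\mathbb{F}_p$ and $v\in\mathbb{F}_p^d$, $\lambda(M,v)$ denotes the map $\mathbb{F}_p^d\to\mathbb{F}_p^d$, $x\mapsto xM+v$. $\operatorname{AGL}_d(p)=\{\lambda(M,v): M\in\operatorname{GL}_d(p), v\in\mathbb{F}_p^d\}$. $\operatorname{CGL}_d(p)$ is the set of matrices $A\in\operatorname{GL}_d(p)$ that do not have $-1$ as an eigenvalue, and $\operatorname{ACGL}_d(p)=\{\lambda(A,v):A\in\operatorname{CGL}_d(p),v\in\mathbb{F}_p^d\}$. Define \[ \Gamma(d,p,\ell)=\begin{cases}\operatorname{CT}(\operatorname{ACGL}_d(p)), & \ell=1,\\ \operatorname{CT}(\operatorname{AGL}_d(p)), & \ell\geq2,\ (d,p)\notin\{(1,2),(1,3),(2,2)\},\\ \emptyset, & \ell\geq2,\ (d,p)=(1,2),\\ \{x_1^3,x_3\}, & \ell\ge2,\ (d,p)=(1,3),\\ \{x_1^4,x_2^2,x_1x_3\}, & \ell\geq 2,\ (d,p)=(2,2).\end{cases} \] For a field $K$, a $K$-vector space $V$ and a subspace $W$, a function $f:V\to V$ is $W$-coset-wise $K$-affine if for each coset $C$ of $W$ in $V$ there are $v_C\in V$ and a $K$-linear endomorphism $\varphi_C$ of $V$ with $\varphi_C(W)\subseteq W$ such that $f(x)=\varphi_C(x)+v_C$ for all $x\in C$. *)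

(* Defs.v *)
From HB Require Import structures.
From mathcomp Require Import all_boot all_order all_algebra all_fingroup.
Set Implicit Arguments. Unset Strict Implicit. Unset Printing Implicit Defensive.
Import GRing.Theory.
Local Open Scope ring_scope.

(* A monomial x_1^{k_1} x_2^{k_2} ... in Q[x_n : n >= 1] is represented by its
   exponent function k : nat -> nat (n |-> exponent of x_n; index 0 unused).
   Products of monomials correspond to pointwise sums of exponent functions. *)
Definition monomial := nat -> nat.

(* monomial given by a list of variable indices with repetition:
   mono [:: 1; 1; 3] = x_1^2 x_3 *)
Definition mono (s : seq nat) : monomial := fun n => count_mem n s.

(* BU_l : x_n |-> x_{l n}, on exponent functions *)
Definition BU (l : nat) (g : monomial) : monomial :=
  fun m => if (l %| m)%N then g (m %/ l)%N else 0%N.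

Definition CT (T : finType) (s : {perm T}) : monomial :=
  fun n => #|[set C in porbits s | #|C| == n]|.

Definition complete (G : finZmodType) (f : {perm G}) : Prop :=
  bijective (fun x => f x + x).

Definition lam (p d : nat) (M : 'M['F_p]_d) (v : 'rV['F_p]_d) :=
  fun x : 'rV['F_p]_d => x *m M + v.

Definition CT_AGL (d p : nat) (g : monomial) : Prop :=
  exists M : 'M['F_p]_d, exists v : 'rV['F_p]_d, exists s : {perm 'rV['F_p]_d},
    M \in unitmx /\ (forall x, s x = lam M v x) /\ CT s =1 g.

Definition CT_ACGL (d p : nat) (g : monomial) : Prop :=
  exists M : 'M['F_p]_d, exists v : 'rV['F_p]_d, exists s : {perm 'rV['F_p]_d},
    M \in unitmx /\ ~~ eigenvalue M (-1) /\
    (forall x, s x = lam M v x) /\ CT s =1 g.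

(* Gamma(d, p, l), as a predicate on monomials (l >= 1 assumed) *)
Definition Gamma (d p l : nat) (g : monomial) : Prop :=
  if l == 1%N then CT_ACGL d p g
  else if (d, p) == (1, 2)%N then False
  else if (d, p) == (1, 3)%N then g =1 mono [:: 1; 1; 1]%N \/ g =1 mono [:: 3]%N
  else if (d, p) == (2, 2)%N then
    g =1 mono [:: 1; 1; 1; 1]%N \/ g =1 mono [:: 2; 2]%N \/ g =1 mono [:: 1; 3]%N
  else CT_AGL d p g.

(* W-coset-wise F_p-affine: W is given as a matrix whose row space is the
   subspace; on each coset x0 + W, f agrees with x |-> x A + v where A
   (a linear endomorphism) maps W into W. *)
Definition coset_affine (p n : nat) (W : 'M['F_p]_n) (f : 'rV['F_p]_n -> 'rV['F_p]_n)
  : Prop :=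
  forall x0 : 'rV['F_p]_n, exists A : 'M['F_p]_n, exists v : 'rV['F_p]_n,
    (W *m A <= W)%MS /\ forall x, (x - x0 <= W)%MS -> f x = x *m A + v.

(* Main.v *)
Require Import Defs.
From HB Require Import structures.
From mathcomp Require Import all_boot all_order all_algebra all_fingroup.
Set Implicit Arguments. Unset Strict Implicit. Unset Printing Implicit Defensive.
Import GRing.Theory.
Local Open Scope ring_scope.

(** Choose coordinates in which the space is X x U with W = X x 0, let f be the given complete
    mapping of U, and put g (x, u) = (phi_u x, f u), where each phi_u is affine on X with linear
    part A_u such that A_u and A_u + 1 are invertible. Then g is W-coset-wise affine and complete.
    Over a cycle C of f, the cycles of g are those of the return map of C (the product of the
    phi_u along C), blown up by the factor |C|. So it remains to write a prescribed affine map of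
    X as a product of l >= 2 such maps, which reduces to factoring an invertible M as A B with
    A, A + 1, B, B + 1 invertible. Taking B = A^-1 M, this asks for a matrix A such that A, A + 1
    and A + M are all invertible. Such an A can be assembled from diagonal blocks of M (with
    minus the upper right block of M as its upper right block), so that 1 x 1 blocks suffice for
    p >= 5, while p = 3 and p = 2 are settled by conjugating M into a convenient shape and
    checking finitely many small matrices. *)

(** * Matrices A with A, A + 1 and A + M invertible *)

Section Avoiding.
Variable F : finFieldType.

Definition avoidable n (M : 'M[F]_n) :=
  exists A : 'M[F]_n, [/\ A \in unitmx, A + 1%:M \in unitmx & A + M \in unitmx].

(** The diagonal blocks alone decide whether an upper block triangular [A] and [A + 1] are
    invertible, so the upper right block of [A] is free: choosing it as [B - ursubmx M] puts an
    arbitrary [B] into that corner of [A + M]. *)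
Lemma avoidable_ublock m n (M : 'M[F]_(m + n)) A1 A2 B :
    A1 \in unitmx -> A1 + 1%:M \in unitmx -> A2 \in unitmx -> A2 + 1%:M \in unitmx ->
    block_mx (A1 + ulsubmx M) B (dlsubmx M) (A2 + drsubmx M) \in unitmx ->
  avoidable M.
Proof.
move=> a1 b1 a2 b2 c.
exists (block_mx A1 (B - ursubmx M) 0 A2); split.
- by rewrite unitmxE det_ublock unitrM -!unitmxE a1.
- rewrite scalar_mx_block add_block_mx !addr0.
  by rewrite unitmxE det_ublock unitrM -!unitmxE b1.
- by rewrite -{2}[M]submxK add_block_mx subrK add0r.
Qed.

(** With [B = 0] the sum [A + M] is lower block triangular, so only the diagonal blocks of [M]
    matter. *)
Lemma avoidable_block m n (M : 'M[F]_(m + n)) :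
  avoidable (ulsubmx M) -> avoidable (drsubmx M) -> avoidable M.
Proof.
move=> [A1 [a1 b1 c1]] [A2 [a2 b2 c2]].
apply: (avoidable_ublock (B := 0) a1 b1 a2 b2).
by rewrite unitmxE det_lblock unitrM -!unitmxE c1.
Qed.

Lemma avoidable_conj n (P M : 'M[F]_n) :
  P \in unitmx -> avoidable (P *m M *m invmx P) -> avoidable M.
Proof.
move=> uP [A [a b c]]; exists (invmx P *m A *m P).
have conjU B : B \in unitmx -> invmx P *m B *m P \in unitmx.
  by move=> uB; rewrite !unitmx_mul unitmx_inv uP uB.
split; first exact: conjU.
- suff -> : invmx P *m A *m P + 1%:M = invmx P *m (A + 1%:M) *m P by exact: conjU.
  by rewrite mulmxDr mulmxDl mulmx1 mulVmx.
- suff -> : invmx P *m A *m P + M = invmx P *m (A + P *m M *m invmx P) *m P.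
    exact: conjU.
  by rewrite mulmxDr mulmxDl !mulmxA mulVmx // mul1mx mulmxKV.
Qed.

(** Since every basis vector e_i is an eigenvector, [M] is diagonal; since e_0 + e_i is one too, the
    diagonal entries agree. *)
Lemma scalar_mx_of_stable_lines n (M : 'M[F]_n) :
  (forall v : 'rV_n, (v *m M <= v)%MS) -> is_scalar_mx M.
Proof.
case: n M => [|n] M stM; first by apply/is_scalar_mxP; exists 0; apply/matrixP=> [[]].
have lineP (v : 'rV_n.+1) : exists a, v *m M = a *: v by apply/sub_rVP.
have rowM i j : i != j -> M i j = 0.
  move=> ne; have [a] := lineP (delta_mx 0 i); rewrite -rowE => /rowP/(_ j).
  by rewrite !mxE eqxx eq_sym (negbTE ne) mulr0 => ->.
apply/is_scalar_mxP; exists (M 0 0); apply/matrixP => i j; rewrite mxE.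
have [<-|ne] := eqVneq i j; last exact: rowM.
have [->|ne0] := eqVneq i 0; first by [].
have [a] := lineP (delta_mx 0 0 + delta_mx 0 i).
rewrite mulmxDl -!rowE => /rowP eqa.
move: (eqa 0) (eqa i); rewrite !mxE eqxx /= (negbTE ne0) [0 == i]eq_sym (negbTE ne0) /=.
rewrite (rowM i 0) // (rowM 0 i) 1?eq_sym // addr0 add0r addr0 add0r mulr1 eqxx mulr1.
by move=> -> ->.
Qed.

(** A non-scalar [M] has a vector [v] with [v] and [v M] independent. If [P] is invertible with row
    [i] equal to [v] and row [j] equal to [v M], then e_i P M = e_j P. *)
Lemma conj_row_delta n (M : 'M[F]_n) (i j : 'I_n) : i != j -> ~~ is_scalar_mx M ->
  exists2 P : 'M[F]_n, P \in unitmx & row i (P *m M *m invmx P) = delta_mx 0 j.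
Proof.
move=> ne nsc.
have [v nv] : exists v : 'rV[F]_n, ~~ (v *m M <= v)%MS.
  by apply/forallPn; apply: contra nsc => /forallP; apply: scalar_mx_of_stable_lines.
pose U : 'M[F]_(1 + 1, n) := col_mx (delta_mx 0 i) (delta_mx 0 j).
pose f : 'M[F]_n := delta_mx i 0 *m v + delta_mx j 0 *m (v *m M).
have Uf : U *m f = col_mx v (v *m M).
  rewrite mul_col_mx !mulmxDr !mulmxA !mul_delta_mx_cond eqxx (negbTE ne) eq_sym (negbTE ne).
  have -> : delta_mx 0 0 = 1%:M :> 'M[F]_1 by apply/matrixP=> a b; rewrite !mxE !ord1.
  by rewrite !mulr0n !mul0mx addr0 add0r eqxx !mulr1n !mul1mx.
have rk2 (x y : 'rV[F]_n) : x != 0 -> ~~ (y <= x)%MS -> \rank (col_mx x y) = 2%N.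
  move=> nzx nyx; have nzy : y != 0 by apply: contraNneq nyx => ->; exact: sub0mx.
  have nx : (x :&: y)%MS = 0.
    apply/eqP; rewrite -submx0; apply/negPn/negP; rewrite submx0 => nz.
    case/negP: nyx; apply: submx_trans (capmxSl x y).
    rewrite -(geq_leqif (mxrank_leqif_sup (capmxSr x y))).
    by apply: leq_trans (rank_leq_row _) _; rewrite lt0n mxrank_eq0.
  by have := mxrank_sum_cap x y; rewrite nx mxrank0 addn0 addsmxE !rank_rV nzx nzy.
have nzv : v != 0 by apply: contraNneq nv => ->; rewrite mul0mx sub0mx.
have nzd : delta_mx 0 i != 0 :> 'rV[F]_n.
  by apply/eqP => /rowP/(_ i); rewrite !mxE !eqxx; apply/eqP; rewrite oner_eq0.
(* [f] sends the independent e_i, e_j to the independent [v], [v M], so its restriction to their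
   span extends to an invertible [g], the required [P]. *)
have [g ug Ug] : {g : 'M_n | g \in unitmx & U *m f = U *m g}.
  apply: complete_unitmx; rewrite Uf !rk2 //.
  apply/sub_rVP => -[a /rowP/(_ j)]; rewrite !mxE !eqxx (eq_sym j) (negbTE ne) mulr0 => /eqP.
  by rewrite oner_eq0.
move: Ug; rewrite Uf mul_col_mx => /eq_col_mx [gi gj].
by exists g => //; rewrite !row_mul rowE -gi gj mulmxK.
Qed.
End Avoiding.

(** * Decision by computation for small matrices over F_p *)

Section Laplace.
Variable p : nat.
Hypothesis p_pr : prime p.
Local Notation F := 'F_p.
Implicit Types (f a m : nat -> nat -> nat) (s w : seq nat).

(* Laplace expansion along the first row, on representatives modulo p; p.-1 stands for -1. *)
Fixpoint laplace (n : nat) f : nat :=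
  if n is n'.+1 then
   (foldr (fun j acc => f 0%N j * ((if odd j then p.-1 else 1) *
                        laplace n' (fun i k => f i.+1 (bump j k))) + acc)%N
          0%N (iota 0 n'.+1) %% p)%N
  else 1.

Definition Fmx n f : 'M[F]_n := \matrix_(i, j) (f i j)%:R.

Lemma Fp_natr_eq0 x : (x%:R == 0 :> F) = (p %| x)%N.
Proof. by rewrite (dvdn_pcharf (pchar_Fp p_pr)). Qed.

Definition laplace_term n f j : nat :=
  f 0%N j * ((if odd j then p.-1 else 1) * laplace n (fun i k => f i.+1 (bump j k))).

Lemma laplaceS n f : laplace n.+1 f = ((\sum_(j < n.+1) laplace_term n f j) %% p)%N.
Proof.
have foldrS (h : nat -> nat) r : foldr (fun j acc => h j + acc)%N 0%N r = (\sum_(j <- r) h j)%N.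
  by elim: r => [|j r IHr]; rewrite ?big_nil ?big_cons //= IHr.
by rewrite -(big_mkord xpredT (laplace_term n f)) -foldrS.
Qed.

Lemma eq_laplace n f g :
  (forall i j, (i < n)%N -> (j < n)%N -> f i j = g i j) -> laplace n f = laplace n g.
Proof.
elim: n f g => [//|n IHn] f g eq_fg; rewrite !laplaceS; congr (_ %% _)%N.
apply: eq_bigr => j _; rewrite /laplace_term eq_fg //.
rewrite (IHn _ (fun i k => g i.+1 (bump j k))) // => i k lt_i lt_k.
by rewrite eq_fg // (@leq_ltn_trans k.+1) // -(add1n k) leq_add2r leq_b1.
Qed.

Lemma det_laplace n f : \det (Fmx n f) = (laplace n f)%:R.
Proof.
elim: n f => [|n IHn] f; first by rewrite det_mx00.
rewrite (expand_det_row _ 0) laplaceS Fp_nat_mod // natr_sum; apply: eq_bigr => j _.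
rewrite mxE /cofactor add0n !natrM -IHn; congr (_ * (_ * _)).
  rewrite -signr_odd; case: odd => //; rewrite expr1; apply/eqP.
  by rewrite eq_sym -subr_eq0 opprK natr1 prednK ?prime_gt0 // Fp_natr_eq0.
by congr (\det _); apply/matrixP => i k; rewrite !mxE.
Qed.

Lemma unitmx_laplace n f : (Fmx n f \in unitmx) = ~~ (p %| laplace n f)%N.
Proof. by rewrite unitmxE unitfE det_laplace Fp_natr_eq0. Qed.

Definition entries (n : nat) s (i j : nat) : nat := nth 0%N s (i * n + j)%N.

Fixpoint words (k : nat) : seq (seq nat) :=
  if k is k'.+1 then [seq x :: w | x <- iota 0 p, w <- words k'] else [:: [::]].

Lemma mem_words k w : size w = k -> all (fun x => x < p)%N w -> w \in words k.
Proof.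
elim: k w => [|k IHk] [|x w] //= [sz] /andP[ltx allw].
by apply/allpairsP; exists (x, w); split; rewrite ?mem_iota //; exact: IHk.
Qed.

Lemma mx_entries n (M : 'M[F]_n) :
  exists2 s, s \in words (n * n) & M = Fmx n (entries n s).
Proof.
case: n M => [|n] M; first by exists [::] => //; apply/matrixP => [[]].
exists (mkseq (fun q => M (inord (q %/ n.+1)) (inord (q %% n.+1)) : nat) (n.+1 * n.+1)).
  apply: mem_words; first by rewrite size_mkseq.
  by apply/allP => x /mapP[y _ ->]; rewrite -[X in (_ < X)%N](Fp_cast p_pr).
apply/matrixP => i j; rewrite mxE /entries nth_mkseq.
  by rewrite divnMDl // divn_small // addn0 modnMDl modn_small // !inord_val natr_Zp.
by rewrite (leq_trans (n := (i * n.+1 + n.+1)%N)) ?ltn_add2l // addnC -mulSn leq_mul2r ltn_ord orbT.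
Qed.

Definition add1 a i j : nat := (a i j + (i == j))%N.

Lemma add1E n a : Fmx n a + 1%:M = Fmx n (add1 a).
Proof. by apply/matrixP => i j; rewrite !mxE natrD. Qed.

Definition complete_fn n a := ~~ (p %| laplace n a)%N && ~~ (p %| laplace n (add1 a))%N.

Lemma complete_fnP n a : complete_fn n a -> Fmx n a \in unitmx /\ Fmx n a + 1%:M \in unitmx.
Proof. by rewrite add1E !unitmx_laplace => /andP. Qed.

Definition avoids n m a :=
  complete_fn n a && ~~ (p %| laplace n (fun i j => a i j + m i j)%N)%N.

Lemma avoidsP n m a : avoids n m a -> avoidable (Fmx n m).
Proof.
case/andP=> /complete_fnP[ha hb] hc; exists (Fmx n a); split => //.
suff -> : Fmx n a + Fmx n m = Fmx n (fun i j => a i j + m i j)%N by rewrite unitmx_laplace.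
by apply/matrixP => i j; rewrite !mxE natrD.
Qed.

(** Exhaustive search: [cs] collects the [A] with [A] and [A + 1] invertible once for all [M], and
    [b] is a computable form of what is assumed about [M]. *)
Lemma avoidable_words n (b : pred (seq nat)) (M : 'M[F]_n) :
    (let cs := [seq s <- words (n * n) | complete_fn n (entries n s)] in
     all (fun w => b w ==> has (fun s => avoids n (entries n w) (entries n s)) cs)
       (words (n * n))) ->
  (forall w, M = Fmx n (entries n w) -> b w) ->
  avoidable M.
Proof.
move=> /allP chk bP; have [m words_m EM] := mx_entries M.
have := chk m words_m; rewrite bP //= => /hasP[a _ av].
by rewrite EM; apply: avoidsP av.
Qed.
End Laplace.

Lemma avoidable_F3_2 (M : 'M['F_3]_2) : avoidable M.
Proof.
apply: (@avoidable_words 3 isT _ xpredT); last by [].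
by vm_compute.
Qed.

Lemma avoidable_F2_3 (M : 'M['F_2]_3) : avoidable M.
Proof.
apply: (@avoidable_words 2 isT _ xpredT); last by [].
by vm_compute.
Qed.

(** Only two matrices [A] have [A] and [A + 1] invertible here, and for a non-scalar [M] with equal
    diagonal entries both sums [A + M] are singular. Hence larger matrices are conjugated before a 2
    x 2 block is split off. *)
Lemma avoidable_F2_2 (M : 'M['F_2]_2) :
  (M 0 0 != M 1 1) || is_scalar_mx M -> avoidable M.
Proof.
move=> hM; pose b (m : seq nat) :=
  (entries 2 m 0 0 != entries 2 m 1 1) ||
  ((2 %| entries 2 m 0 1)%N && (2 %| entries 2 m 1 0)%N).
apply: (@avoidable_words 2 isT _ b); first by vm_compute.
move=> m EM; move: hM; rewrite EM !mxE /b => /orP[h|].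
  by apply/orP; left; apply: contraNneq h => ->.
case/is_scalar_mxP => a /matrixP Ea; apply/orP; right.
by have := Ea 0 1; have := Ea 1 0; rewrite !mxE /= -!Fp_natr_eq0 // => -> ->; rewrite eqxx.
Qed.

(** The block matrix of [avoidable_ublock] with 2 x 2 blocks, on representatives; the upper right
    block of [m] is never read. *)
Definition ublock_fn (c : seq nat * seq nat * seq nat) (m : nat -> nat -> nat) i j : nat :=
  let: (a1, a2, b) := c in
  if (i < 2)%N then if (j < 2)%N then (entries 2 a1 i j + m i j)%N else entries 2 b i (j - 2)
  else if (j < 2)%N then m i j else (entries 2 a2 (i - 2) (j - 2) + m i j)%N.

(* The entries of M = [P Q; R D] with e_2 M = e_0, in the word P 0, P 1, M 3; the block Q, which
   is cancelled by the choice of A, is not represented. *)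
Definition row2_unit_fn (w : seq nat) i j : nat :=
  nth 0%N (nth [::] [:: take 2 w; take 2 (drop 2 w); [:: 1; 0; 0; 0]; drop 4 w]%N i) j.

(* The two 2 x 2 matrices over F_2 without eigenvalue in F_2, and an arbitrary upper right block. *)
Definition ublock_candidates :=
  let cs := [:: [:: 0; 1; 1; 1]; [:: 1; 1; 1; 0]]%N in
  [seq (ac, b) | ac <- [seq (a1, a2) | a1 <- cs, a2 <- cs], b <- words 2 4].

Lemma ublock_fnE (M : 'M['F_2]_(2 + 2)) (e : nat -> nat -> nat) a1 a2 b :
    (forall i j : 'I_(2 + 2), M i j = (e i j)%:R) ->
  block_mx (Fmx 2 2 (entries 2 a1) + ulsubmx M) (Fmx 2 2 (entries 2 b)) (dlsubmx M)
   (Fmx 2 2 (entries 2 a2) + drsubmx M) = Fmx 2 (2 + 2) (ublock_fn (a1, a2, b) e).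
Proof.
move=> eE; apply/matrixP => i j; rewrite [RHS]mxE.
case: (split_ordP i) => i' ->; case: (split_ordP j) => j' ->;
  rewrite ?block_mxEul ?block_mxEur ?block_mxEdl ?block_mxEdr /ublock_fn !mxE.
- by rewrite [nat_of_ord (lshift _ _)]/= [nat_of_ord (lshift _ j')]/= !ltn_ord natrD eE.
- rewrite [nat_of_ord (lshift _ _)]/= [nat_of_ord (rshift _ j')]/= ltn_ord.
  by rewrite ltnNge leq_addr /= addKn.
- rewrite [nat_of_ord (rshift _ _)]/= [nat_of_ord (lshift _ j')]/= ltn_ord.
  by rewrite ltnNge leq_addr /= eE.
- rewrite [nat_of_ord (rshift _ _)]/= [nat_of_ord (rshift _ j')]/=.
  by rewrite ltnNge leq_addr [(_ + j' < _)%N]ltnNge leq_addr /= !addKn natrD eE.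
Qed.

Lemma ublock_candidatesP :
  all (fun w => has (fun c => ~~ (2 %| laplace 2 4 (ublock_fn c (row2_unit_fn w)))%N)
    ublock_candidates) (words 2 8).
Proof. by vm_compute. Qed.

(** Row 2 is known and the upper right block is irrelevant, so 8 of the 16 entries remain and 2^8
    words cover all cases. *)
Lemma avoidable_F2_4_row (M : 'M['F_2]_(2 + 2)) :
  row (inord 2) M = delta_mx 0 (inord 0) -> avoidable M.
Proof.
move=> rowM; pose e i j : nat := M (inord i) (inord j).
have eE (i j : 'I_(2 + 2)) : M i j = (e i j)%:R by rewrite /e !inord_val natr_Zp.
have lt_e i j : (e i j < 2)%N by exact: ltn_ord.
have e2 j : (j < 4)%N -> e 2 j = (j == 0%N).
  move=> lt_j; rewrite /e; have := congr1 (fun v : 'rV__ => v 0 (inord j)) rowM.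
  rewrite !mxE => ->; rewrite eqxx /= -val_eqE /= !inordK //.
  by case: eqP.
pose w := [:: e 0 0; e 0 1; e 1 0; e 1 1; e 3 0; e 3 1; e 3 2; e 3 3]%N.
have words_w : w \in words 2 8 by apply: (@mem_words 2 8 w erefl); rewrite /w /= !lt_e.
have /hasP[c] := allP ublock_candidatesP w words_w.
have -> : laplace 2 4 (ublock_fn c (row2_unit_fn w)) = laplace 2 4 (ublock_fn c e).
  apply: eq_laplace => i j lt_i lt_j; rewrite /ublock_fn.
  case: c => [[a1 a2] b]; case: i lt_i => [|[|[|[|//]]]] _; case: j lt_j => [|[|[|[|//]]]] _ //=;
    rewrite /row2_unit_fn /= ?e2 //.
case/allpairsP => -[ac b] [/allpairsP[[a1' a2'] [h1 h2 Eac]] _ ->] {c}.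
rewrite [(ac, b).1]/= in Eac; rewrite {ac}Eac [(_, _).1]/= [(_, _).2]/= in h1 h2 *.
rewrite -(unitmx_laplace (p := 2)) // => uN.
have cmpl a : a \in [:: [:: 0; 1; 1; 1]; [:: 1; 1; 1; 0]]%N ->
    Fmx 2 2 (entries 2 a) \in unitmx /\ Fmx 2 2 (entries 2 a) + 1%:M \in unitmx.
  by move=> h; apply: complete_fnP => //; apply/allP: a h; vm_compute.
have [u1 v1] := cmpl _ h1; have [u2 v2] := cmpl _ h2.
apply: (avoidable_ublock (B := Fmx 2 2 (entries 2 b)) u1 v1 u2 v2).
by rewrite (ublock_fnE _ _ _ eE).
Qed.

(** * Existence over F_p *)

Lemma avoidable_mx11 (F : finFieldType) (a : F) (M : 'M[F]_1) :
  a \notin [:: 0; -1; - M 0 0] -> avoidable M.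
Proof.
rewrite !inE !negb_or => /and3P[a0 a1 aM]; exists a%:M.
split; rewrite unitmxE unitfE det_mx11 !mxE mulr1n //.
- by rewrite -[1]opprK subr_eq0.
- by rewrite -[M 0 0]opprK subr_eq0.
Qed.

(** Each 1 x 1 block has at most three forbidden scalars, fewer than [p]. *)
Lemma avoidable_large_field p n (M : 'M['F_p]_n) : prime p -> (3 < p)%N -> avoidable M.
Proof.
move=> p_pr gt3; elim: n M => [|n IHn] M.
  by exists 0; split; rewrite unitmxE det_mx00 unitr1.
apply: (@avoidable_block _ 1 n) (IHn _).
set N := ulsubmx _; pose s := [:: 0; -1; - N 0 0].
have [a] : exists a, a \notin s.
  apply/existsP; rewrite -negb_forall; apply/negP => /forallP all_s.
  have : (#|'F_p| <= size s)%N.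
    by rewrite cardE; apply: uniq_leq_size (enum_uniq _) _ => x _; exact: all_s.
  by rewrite card_Fp // leqNgt gt3.
exact: avoidable_mx11.
Qed.

Lemma scalar_ulsubmx (F : finFieldType) m n (a : F) : ulsubmx (a%:M : 'M_(m + n)) = a%:M.
Proof. by rewrite scalar_mx_block block_mxKul. Qed.

Lemma scalar_drsubmx (F : finFieldType) m n (a : F) : drsubmx (a%:M : 'M_(m + n)) = a%:M.
Proof. by rewrite scalar_mx_block block_mxKdr. Qed.

Lemma avoidable_F3_scalar3 (a : 'F_3) : avoidable (a%:M : 'M_3).
Proof.
(* The companion matrix of X^3 - X - 1, which has no root in F_3. *)
pose c := entries 3 [:: 0; 1; 0; 0; 0; 1; 1; 1; 0]%N.
have -> : a%:M = Fmx 3 3 (fun i j => if i == j then nat_of_ord a else 0%N).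
  apply/matrixP => i j; rewrite !mxE -val_eqE; case: eqP => _ //=.
  by rewrite natr_Zp.
apply: (@avoidsP 3 isT 3 _ c).
by case: a => [[|[|[|//]]] lta]; vm_compute.
Qed.

Lemma avoidable_F3 n (M : 'M['F_3]_n) : (1 < n)%N -> avoidable M.
Proof.
have [k] := ubnP n; elim: k n M => // k IHk [|[|[|[|n]]]] M // ltk _.
- exact: avoidable_F3_2.
- have [/is_scalar_mxP[a ->]|nsc] := boolP (is_scalar_mx M); first exact: avoidable_F3_scalar3.
  have [|P uP rowP] := conj_row_delta (i := 0) (j := 1) _ nsc; first by [].
  apply: (avoidable_conj uP); apply: (@avoidable_block _ 1 2); last exact: avoidable_F3_2.
  (* Row 0 is now e_1, so the entry (0, 0) vanishes, and 1 differs from both 0 and -1 in F_3. *)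
  apply: (avoidable_mx11 (a := 1)); rewrite !mxE.
  have -> : lshift 2 (0 : 'I_1) = 0 :> 'I_3 by exact: val_inj.
  have := congr1 (fun v : 'rV__ => v 0 0) rowP; rewrite !mxE => ->.
  by vm_compute.
- apply: (@avoidable_block _ 2 n.+2); first exact: avoidable_F3_2.
  by apply: IHk => //; rewrite -ltnS ltnW.
Qed.

Lemma addr_F2 (x : 'F_2) : x + x = 0.
Proof. by rewrite -mulr2n -mulr_natr -[2%N]/(pdiv 2) pchar_Zp ?mulr0. Qed.

(* If e_2 M = e_0 then adding row 2 to row 0 (and subtracting
   column 0 from column 2) changes the entry (0, 0) by 1 and keeps the entry (1, 1). *)
Lemma conj_diag_neq_F2 n (M : 'M['F_2]_(2 + n.+1)) : ~~ is_scalar_mx M ->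
  exists2 P, P \in unitmx &
    (ulsubmx (P *m M *m invmx P)) 0 0 != (ulsubmx (P *m M *m invmx P)) 1 1.
Proof.
move=> nsc.
pose i0 : 'I_(2 + n.+1) := lshift _ 0; pose i1 : 'I_(2 + n.+1) := lshift _ 1.
pose i2 : 'I_(2 + n.+1) := rshift 2 0.
have [//|P uP rowP] := conj_row_delta (i := i2) (j := i0) _ nsc.
set N := P *m M *m invmx P in rowP.
have ulE (Q : 'M['F_2]_(2 + n.+1)) i j : ulsubmx Q i j = Q (lshift _ i) (lshift _ j).
  by rewrite !mxE.
have [neq|] := boolP (N i0 i0 != N i1 i1); first by exists P; rewrite // !ulE.
rewrite negbK => /eqP eq01.
pose T : 'M['F_2]_(2 + n.+1) := 1%:M + delta_mx i0 i2.
have TT : T *m T = 1%:M.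
  rewrite /T mulmxDl mul1mx mulmxDr mulmx1 mul_delta_mx_cond mulr0n addr0.
  rewrite -addrA; apply/matrixP => i j; by rewrite !mxE addr_F2 addr0.
have uT : T \in unitmx by case/mulmx1_unit: TT.
have iT : invmx T = T by rewrite -[RHS]mul1mx -(mulVmx uT) -mulmxA TT mulmx1.
have uTP : T *m P \in unitmx by rewrite unitmx_mul uT.
exists (T *m P); first exact: uTP.
have -> : T *m P *m M *m invmx (T *m P) = T *m N *m T.
  have -> : invmx (T *m P) = invmx P *m T.
    apply: (can_inj (mulKmx uTP)).
    by rewrite mulmxV // !mulmxA mulmxK.
  by rewrite /N !mulmxA.
have DN (Q : 'M['F_2]_(2 + n.+1)) i j :
    (delta_mx i0 i2 *m Q) i j = (i == i0)%:R * Q i2 j.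
  rewrite mxE (bigD1 i2) //= big1 => [|k nk]; first by rewrite mxE eqxx andbT addr0.
  by rewrite mxE (negbTE nk) andbF mul0r.
have ND (Q : 'M['F_2]_(2 + n.+1)) i j :
    (Q *m delta_mx i0 i2) i j = Q i i0 * (j == i2)%:R.
  rewrite mxE (bigD1 i0) //= big1 => [|k nk]; first by rewrite mxE eqxx addr0.
  by rewrite mxE (negbTE nk) mulr0.
have N20 : N i2 i0 = 1.
  by have := congr1 (fun v : 'rV__ => v 0 i0) rowP; rewrite !mxE !eqxx.
rewrite !ulE -/i0 -/i1 mulmxDr mulmx1 mulmxDl mul1mx.
rewrite [X in X != _]mxE [X in X + _ != _]mxE ND mulr0 addr0 DN eqxx mul1r N20.
rewrite [X in _ != X]mxE [X in _ != X + _]mxE ND mulr0 addr0 DN mul0r addr0 eq01.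
by rewrite -subr_eq0 addrAC subrr add0r oner_eq0.
Qed.

(** From size 5 on, a good 2 x 2 block is split off and the rest has size at least 3. Size 4 is
    treated apart because there the rest is again 2 x 2 and could be a bad block. *)
Lemma avoidable_F2 n (M : 'M['F_2]_n) : (2 < n)%N -> avoidable M.
Proof.
have [k] := ubnP n; elim: k n M => // k IHk [|[|[|[|[|n]]]]] M // ltk _.
- exact: avoidable_F2_3.
- have [/is_scalar_mxP[a ->]|nsc] := boolP (is_scalar_mx M).
    apply: (@avoidable_block _ 2 2); rewrite ?scalar_ulsubmx ?scalar_drsubmx;
      by apply: avoidable_F2_2; rewrite scalar_mx_is_scalar orbT.
  have [|P uP rowP] := conj_row_delta (i := inord 2) (j := inord 0) _ nsc.
    by rewrite -val_eqE /= !inordK.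
  by apply: (avoidable_conj uP); apply: avoidable_F2_4_row.
- have IH (N : 'M['F_2]_n.+3) : avoidable N by apply: IHk => //; rewrite -ltnS ltnW.
  have [/is_scalar_mxP[a ->]|nsc] := boolP (is_scalar_mx M).
    apply: (@avoidable_block _ 2 n.+3); last exact: IH.
    by rewrite scalar_ulsubmx; apply: avoidable_F2_2; rewrite scalar_mx_is_scalar orbT.
  have [P uP neq] := @conj_diag_neq_F2 n.+2 _ nsc.
  apply: (avoidable_conj uP); apply: (@avoidable_block _ 2 n.+3); last exact: IH.
  by apply: avoidable_F2_2; rewrite neq.
Qed.

Lemma avoidable_Fp d p (M : 'M['F_p]_d) : prime p -> (0 < d)%N ->
  (d, p) != (1, 2)%N -> (d, p) != (1, 3)%N -> (d, p) != (2, 2)%N -> avoidable M.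
Proof.
move=> p_pr d_gt0; have [gt3|le3] := ltnP 3 p; first by move=> *; exact: avoidable_large_field.
case: p p_pr le3 M => [|[|[|[|//]]]] // _ _ M.
  by case: d d_gt0 M => [|[|[|d]]] // _ M *; exact: avoidable_F2.
by case: d d_gt0 M => [|[|d]] // _ M *; exact: avoidable_F3.
Qed.

(** * Cycle types and skew products *)

Section CycleType.
Variable T : finType.
Implicit Types (s : {perm T}) (x : T).

Lemma card_porbit_gt0 s x : (0 < #|porbit s x|)%N.
Proof. by rewrite lt0n card_porbit_neq0. Qed.

Lemma iter_eq_id_dvdn s x m : (iter m s x == x) = (#|porbit s x| %| m)%N.
Proof.
have l_gt0 := card_porbit_gt0 s x; set l := #|porbit s x| in l_gt0 *.
have iterM q : iter (q * l) s x = x.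
  by elim: q => // q IHq; rewrite mulSn iterD IHq iter_porbit.
rewrite [in LHS](divn_eq m l) addnC iterD iterM /dvdn.
have lt_r := ltn_pmod m l_gt0; apply/eqP/eqP => [Ex|-> //].
have := @nth_uniq _ x (traject s x l) (m %% l) 0; rewrite size_traject.
move=> /(_ lt_r l_gt0 (uniq_traject_porbit s x)).
by rewrite !nth_traject // Ex eqxx => /esym/eqP.
Qed.

Lemma card_porbitE s x n : (forall m, (iter m s x == x) = (n %| m)%N) -> #|porbit s x| = n.
Proof.
move=> iterE; apply/eqP; rewrite eqn_dvd -iter_eq_id_dvdn iterE dvdnn /=.
by rewrite -iterE iter_eq_id_dvdn.
Qed.

Lemma CT_0 s : CT s 0 = 0%N.
Proof.
apply/eqP; rewrite cards_eq0; apply/eqP/setP => C; rewrite !inE.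
apply/negP => /andP[/imsetP[x _ ->]]; exact/negP/card_porbit_neq0.
Qed.

(** Replaces the count of cycles by a count of points, which can be split over fibres. *)
Lemma muln_CT s n : (n * CT s n)%N = #|[set x | #|porbit s x| == n]|.
Proof.
rewrite -[RHS]sum1_card (partition_big (porbit s) (mem [set C in porbits s | #|C| == n])) /=.
  rewrite mulnC -sum_nat_const; apply: eq_bigr => C; rewrite inE => /andP[/imsetP[y _ ->] /eqP <-].
  rewrite -[LHS]sum1_card; apply: eq_bigl => x; rewrite inE eq_porbit_mem.
  have [|_] := boolP (x \in _); last by rewrite andbF.
  by rewrite -eq_porbit_mem => /eqP ->; rewrite eqxx.
by move=> x; rewrite !inE => ->; rewrite imset_f.
Qed.

Lemma CT_eq s (g : monomial) : g 0%N = 0%N ->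
  (forall n, (0 < n)%N -> #|[set x | #|porbit s x| == n]| = (n * g n)%N) -> CT s =1 g.
Proof.
move=> g0 gn [|n]; first by rewrite CT_0 g0.
by apply/eqP; rewrite -(eqn_pmul2l (ltn0Sn n)) muln_CT gn.
Qed.
End CycleType.

Section SkewProduct.
Variables (X U T : finType) (f : {perm U}) (phi : U -> {perm X}).
Variables (g : {perm T}) (h : X * U -> T).
Hypothesis bij_h : bijective h.
Hypothesis gh : forall x u, g (h (x, u)) = h (phi u x, f u).

(** Permutations multiply from left to right, so [phi u] acts first; for [m] the length of the cycle
    of [u] this is the return map to the fibre over [u]. *)
Definition return_perm m u : {perm X} := (\prod_(j < m) phi ((f ^+ j) u))%g.

Lemma iter_skew m x u : iter m g (h (x, u)) = h (return_perm m u x, iter m f u).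
Proof.
elim: m => [|m IHm]; first by rewrite /return_perm big_ord0 perm1.
by rewrite iterS IHm gh /return_perm big_ord_recr /= permM permX.
Qed.

(** The orbit of (x, u) can close only after a multiple of the length of the cycle of [u], and each
    full turn applies the return map once to [x]. *)
Lemma card_porbit_skew x u : #|porbit g (h (x, u))| =
  (#|porbit f u| * #|porbit (return_perm #|porbit f u| u) x|)%N.
Proof.
set l := #|porbit f u|; apply: card_porbitE => m.
have [/dvdnP[q ->]|ndv] := boolP (l %| m)%N; last first.
  rewrite iter_skew (inj_eq (bij_inj bij_h)) xpair_eqE iter_eq_id_dvdn (negbTE ndv) andbF.
  by apply/esym/negbTE; apply: contra ndv => /(dvdn_trans _)->; rewrite ?dvdn_mulr.
have -> : iter (q * l) g (h (x, u)) = h (iter q (return_perm l u) x, u).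
  by elim: q => // q IHq; rewrite mulSn iterD IHq iter_skew iter_porbit.
rewrite (inj_eq (bij_inj bij_h)) xpair_eqE eqxx andbT iter_eq_id_dvdn mulnC.
by rewrite dvdn_pmul2r // card_porbit_gt0.
Qed.

Lemma CT_skew (r : {set U} -> U) n : (forall C, C \in porbits f -> r C \in C) ->
  CT g n = (\sum_(C in porbits f) BU #|C| (CT (return_perm #|C| (r C))) n)%N.
Proof.
move=> rP; case: n => [|n].
  by rewrite CT_0 big1 // => C _; rewrite /BU dvdn0 div0n CT_0.
(* [N u] counts the points over [u] on cycles of length [n.+1]. It is constant along cycles of [f],
   since [g] carries the fibre over [u] bijectively to that over [f u]. *)
pose N u := (\sum_x (#|porbit g (h (x, u))| == n.+1))%N.
have Nf u : N (f u) = N u.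
  rewrite /N (reindex_inj (@perm_inj _ (phi u))); apply: eq_bigr => x _.
  by rewrite -gh; have := porbit_perm g 1 (h (x, u)); rewrite expg1 => ->.
have Nporbit u v : v \in porbit f u -> N v = N u.
  case/porbitP => i ->; rewrite permX.
  by elim: i => //= i IHi; rewrite Nf.
apply/eqP; rewrite -(eqn_pmul2l (ltn0Sn n)) muln_CT big_distrr /=; apply/eqP.
have -> : #|[set y | #|porbit g y| == n.+1]| = (\sum_u N u)%N.
  rewrite -sum1_card big_mkcond /= (reindex h) /=; last exact: onW_bij.
  rewrite /N exchange_big /= pair_bigA /=; apply: eq_bigr => -[x u] _ /=.
  by rewrite inE; case: eqP.
rewrite (partition_big (porbit f) (mem (porbits f))) /=; last by move=> u _; apply: imset_f.
apply: eq_bigr => C CP; have rC := rP C CP; have [u0 _ EC] := imsetP CP.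
have EC' : C = porbit f (r C) by apply/esym/eqP; rewrite {2}EC eq_porbit_mem -EC.
transitivity (\sum_(u in C) N (r C))%N.
  apply: eq_big => [u|u /eqP Eu]; first by rewrite {1}EC' eq_porbit_mem -EC'.
  by apply: Nporbit; rewrite -EC' -Eu porbit_id.
have C_gt0 : (0 < #|C|)%N by rewrite EC card_porbit_gt0.
have NE : N (r C) = #|[set x | (#|C| * #|porbit (return_perm #|C| (r C)) x|)%N == n.+1]|.
  rewrite -sum1_card big_mkcond /=; apply: eq_bigr => x _; rewrite inE card_porbit_skew -EC'.
  by case: eqP.
rewrite sum_nat_const NE /BU; case: ifPn => [/dvdnP[q Eq]|ndv].
  rewrite Eq mulnK // -[RHS]mulnA [RHS]mulnCA muln_CT; congr (_ * _)%N.
  by apply: eq_card => x; rewrite !inE mulnC eqn_pmul2r.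
rewrite muln0 (_ : [set x | _] = set0) ?cards0 ?muln0 //; apply/setP => x; rewrite !inE.
by apply: contraNF ndv => /eqP <-; rewrite dvdn_mulr.
Qed.
End SkewProduct.

(** * Factorization into complete affine maps *)

Section AffineFactorization.
Variables (p d : nat).
Local Notation V := 'rV['F_p]_d.
Implicit Types (A B M : 'M['F_p]_d) (s : {perm V}).

Definition complete_mx A := A \in unitmx /\ A + 1%:M \in unitmx.

Definition acgl_perm s := exists A v, complete_mx A /\ forall x, s x = lam A v x.

Lemma eigenvalueN1 A : eigenvalue A (-1) = (A + 1%:M \notin unitmx).
Proof. by rewrite /eigenvalue /eigenspace kermx_eq0 row_free_unit raddfN /= opprK. Qed.

Lemma lam_permP A v : A \in unitmx -> exists s, forall x, s x = lam A v x.
Proof.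
move=> uA; have inj_lam : injective (lam A v).
  by move=> x y /addIr/(congr1 (mulmx^~ (invmx A))); rewrite !mulmxK.
by exists (perm inj_lam) => x; rewrite permE.
Qed.

Lemma acgl_perm_of A v : complete_mx A -> exists s, acgl_perm s /\ forall x, s x = lam A v x.
Proof.
by move=> cA; have [s sE] := lam_permP v cA.1; exists s; split => //; exists A, v.
Qed.

Lemma lam_prod A B v s1 s2 s : (forall x, s1 x = lam A 0 x) -> (forall x, s2 x = lam B v x) ->
  (forall x, s x = lam (A *m B) v x) -> s = (s1 * s2)%g.
Proof.
move=> E1 E2 E; apply/permP => x.
by rewrite permM E E1 E2 /lam addr0 mulmxA.
Qed.

(** [H] is a class of matrices from which a complete factor can be split off without leaving the
    class ([step]), until two complete factors finish ([two]). The whole translation part goes into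
    the last factor. *)
Lemma acgl_factor (H : 'M['F_p]_d -> Prop) :
    (forall M, H M -> exists A B, [/\ complete_mx A, complete_mx B & M = A *m B]) ->
    (forall M, H M -> exists A B, [/\ complete_mx A, H B & M = A *m B]) ->
    (forall M, H M -> M \in unitmx) ->
  forall l M v s, (1 < l)%N -> H M -> (forall x, s x = lam M v x) ->
  exists sigma : nat -> {perm V},
    (forall j, acgl_perm (sigma j)) /\ s = (\prod_(j < l) sigma j)%g.
Proof.
move=> two step unitH [//|[//|l]] M v s _.
elim: l M s => [|l IHl] M s HM sE.
  have [A [B [cA cB EM]]] := two M HM; rewrite {}EM in sE.
  have [s1 [a1 E1]] := acgl_perm_of 0 cA; have [s2 [a2 E2]] := acgl_perm_of v cB.
  exists (fun j => if j is 0%N then s1 else s2); split; first by case.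
  by rewrite big_ord_recl big_ord1; apply: lam_prod E1 E2 sE.
have [A [B [cA HB EM]]] := step M HM; rewrite {}EM in sE.
have [s1 [a1 E1]] := acgl_perm_of 0 cA; have [s2 E2] := lam_permP v (unitH _ HB).
have [sigma [asg Es2]] := IHl B s2 HB E2.
exists (fun j => if j is j'.+1 then sigma j' else s1); split; first by case.
by rewrite big_ord_recl -[X in (_ * X)%g]Es2; apply: lam_prod E1 E2 sE.
Qed.

(** For B = A^-1 M one has B + 1 = A^-1 (M + A), which is where invertibility of [A + M] enters. *)
Lemma avoidable_factor M : (forall N, @avoidable 'F_p d N) -> M \in unitmx ->
  exists A B, [/\ complete_mx A, complete_mx B & M = A *m B].
Proof.
move=> av uM; have [A [a b c]] := av M; exists A, (invmx A *m M); split; first exact: conj a b.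
  split; first by rewrite unitmx_mul unitmx_inv a uM.
  by rewrite -(mulVmx a) -mulmxDr addrC unitmx_mul unitmx_inv a c.
by rewrite mulKVmx.
Qed.
End AffineFactorization.

(** * Cycle types of identities, translations and an element of order 3 *)

Lemma CT_uniform (T : finType) (s : {perm T}) c k :
  (forall x, #|porbit s x| = c) -> (c * k)%N = #|T| -> (0 < c)%N -> CT s =1 mono (nseq k c).
Proof.
move=> sz_s Eck c_gt0; apply: CT_eq => [|n n_gt0]; rewrite /mono count_nseq /=.
  by rewrite (gtn_eqF c_gt0) mul0n.
have [<-|ne] := eqVneq c n.
  by rewrite mul1n Eck; apply: eq_card => x; rewrite !inE sz_s eqxx.
rewrite mul0n muln0; apply: eq_card0 => x; rewrite !inE sz_s; exact/negbTE.
Qed.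

Lemma CT_id (p d : nat) (s : {perm 'rV['F_p]_d}) : prime p -> (forall x, s x = lam 1%:M 0 x) ->
  CT s =1 mono (nseq (p ^ d) 1).
Proof.
move=> p_pr sE; apply: CT_uniform => //; last by rewrite card_mx card_Fp // !mul1n.
move=> x; apply: card_porbitE => m; rewrite dvd1n; apply/eqP.
by elim: m => //= m ->; rewrite sE /lam mulmx1 addr0.
Qed.

Lemma CT_translation (p d : nat) (s : {perm 'rV['F_p]_d}) v : prime p -> (0 < d)%N -> v != 0 ->
  (forall x, s x = lam 1%:M v x) -> CT s =1 mono (nseq (p ^ d.-1) p).
Proof.
move=> p_pr d_gt0 nzv sE; apply: CT_uniform; last exact: prime_gt0.
  move=> x; apply: card_porbitE => m.
  have -> : iter m s x = x + v *+ m.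
    elim: m => [|m IHm]; first by rewrite mulr0n addr0.
    by rewrite iterS IHm sE /lam mulmx1 mulrSr addrA.
  rewrite -subr_eq0 addrAC subrr add0r -scaler_nat scaler_eq0 (negbTE nzv) orbF.
  exact: Fp_natr_eq0.
by rewrite -expnS prednK // card_mx card_Fp // mul1n.
Qed.

(* w generates the field with 4 elements inside the 2 x 2 matrices over F_2. *)
Section F4.
Local Notation w := (Fmx 2 2 (entries 2 [:: 0; 1; 1; 1]%N)).

Lemma sqr_w : w *m w = w + 1%:M.
Proof.
apply/matrixP => i j; rewrite !mxE !big_ord_recl big_ord0 !mxE.
by apply/eqP; case: i => [[|[|//]] ?]; case: j => [[|[|//]] ?]; vm_compute.
Qed.

Lemma addmx_F2 m n (A : 'M['F_2]_(m, n)) : A + A = 0.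
Proof. by apply/matrixP => i j; rewrite !mxE addr_F2. Qed.

Lemma mul_w_sqr : w *m (w + 1%:M) = 1%:M.
Proof. by rewrite mulmxDr mulmx1 sqr_w addrAC addmx_F2 add0r. Qed.

Lemma sqr_w1 : (w + 1%:M) *m (w + 1%:M) = w.
Proof. by rewrite mulmxDl mul_w_sqr mul1mx addrC -addrA addmx_F2 addr0. Qed.

Lemma complete_w : complete_mx w.
Proof. exact: complete_fnP. Qed.

Lemma complete_w1 : complete_mx (w + 1%:M).
Proof.
have [u v] := complete_w; split; first exact: v.
rewrite -addrA addmx_F2 addr0; exact: u.
Qed.

(** As [w + 1] is the square of [w], this is the group of order 3 generated by [w]. *)
Definition cyclic3 (M : 'M['F_2]_2) := [\/ M = 1%:M, M = w | M = w + 1%:M].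

(** The complete elements [w] and w^2 already generate all products needed: 1 = w w^2, w = w^2 w^2
    and w^2 = w w. *)
Lemma cyclic3_factor l M v (s : {perm 'rV['F_2]_2}) :
    (1 < l)%N -> cyclic3 M -> (forall x, s x = lam M v x) ->
  exists sigma : nat -> {perm 'rV['F_2]_2},
    (forall j, acgl_perm (sigma j)) /\ s = (\prod_(j < l) sigma j)%g.
Proof.
move=> l_gt1 cM sE; apply: (acgl_factor (H := cyclic3) _ _ _ l_gt1 cM sE) => {cM v s sE M} M.
- case=> ->.
  + by exists w, (w + 1%:M); rewrite mul_w_sqr; split; [exact: complete_w|exact: complete_w1|].
  + by exists (w + 1%:M), (w + 1%:M); rewrite sqr_w1; split; try exact: complete_w1.
  + by exists w, w; rewrite sqr_w; split; try exact: complete_w.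
- case=> ->; exists w.
  + by exists (w + 1%:M); rewrite mul_w_sqr; split; [exact: complete_w|exact: Or33|].
  + by exists 1%:M; rewrite mulmx1; split; [exact: complete_w|exact: Or31|].
  + by exists w; rewrite sqr_w; split; [exact: complete_w|exact: Or32|].
- by case=> ->; [rewrite unitmx1 | case: complete_w | case: complete_w1].
Qed.

Lemma CT_w (s : {perm 'rV['F_2]_2}) : (forall x, s x = lam w 0 x) -> CT s =1 mono [:: 1; 3]%N.
Proof.
move=> sE; have sE' x : s x = x *m w by rewrite sE /lam addr0.
have sz0 : #|porbit s 0| = 1%N.
  apply: card_porbitE => m; rewrite dvd1n; apply/eqP.
  by elim: m => //= m ->; rewrite sE' mul0mx.
have sz3 x : x != 0 -> #|porbit s x| = 3%N.
  move=> nzx; have : (#|porbit s x| %| 3)%N.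
    rewrite -iter_eq_id_dvdn /= !sE' -!mulmxA sqr_w mul_w_sqr mulmx1 //.
  have : ~~ (#|porbit s x| %| 1)%N.
    rewrite -iter_eq_id_dvdn /= sE'; apply: contra nzx => /eqP Ex.
    apply/eqP; rewrite -[LHS](mulmxK complete_w1.1) mulmxDr mulmx1 Ex addmx_F2.
    exact: mul0mx.
  by rewrite dvdn1 dvdn_divisors // !inE => /negbTE-> /eqP.
apply: CT_eq => // n n_gt0.
have -> : #|[set x | #|porbit s x| == n]| = ((n == 1) + 3 * (n == 3))%N.
  rewrite (cardD1 0) inE sz0 eq_sym; congr (_ + _)%N.
  have [->|ne3] := eqVneq n 3%N.
    transitivity #|predC1 (0 : 'rV['F_2]_2)|.
      by apply: eq_card => x; rewrite !inE; case: eqVneq => //= nz; rewrite sz3.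
    by rewrite cardC1 card_mx card_Fp.
  apply: eq_card0 => x; rewrite !inE; case: eqVneq => //= nz; rewrite sz3 // eq_sym; exact/negbTE.
rewrite /mono /= addn0 [1%N == n]eq_sym [3%N == n]eq_sym.
by case: n n_gt0 => [|[|[|[|n]]]] // _; rewrite !muln0.
Qed.
End F4.

Lemma Gamma_factor d p l g : prime p -> (0 < d)%N -> (0 < l)%N -> Gamma d p l g ->
  exists sigma : nat -> {perm 'rV['F_p]_d},
    (forall j, acgl_perm (sigma j)) /\ CT (\prod_(j < l) sigma j)%g =1 g.
Proof.
move=> p_pr d_gt0 l_gt0; rewrite /Gamma; have [->|l1] := eqVneq l 1%N.
  case=> M [v [s [uM [eM [sE CTs]]]]]; exists (fun=> s); rewrite big_ord1; split => // _.
  by exists M, v; split => //; split => //; rewrite eigenvalueN1 negbK in eM.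
have {l1} l_gt1 : (1 < l)%N by rewrite ltn_neqAle eq_sym l1.
have [//|n12] := eqVneq (d, p) (1, 2)%N.
have [[Ed Ep]|n13] := eqVneq (d, p) (1, 3)%N.
  (* In F_3 both 1 and 1 + 1 are invertible, so the linear part can be 1 in every factor; the
     identity and a nonzero translation realize the two cycle types. *)
  subst d p => Hg; have c1 : complete_mx (1%:M : 'M['F_3]_1).
    by split; rewrite ?unitmx1 // unitmxE unitfE det_mx11 !mxE.
  have fac v (s : {perm 'rV['F_3]_1}) : (forall x, s x = lam 1%:M v x) ->
      exists sigma : nat -> {perm 'rV['F_3]_1},
      (forall j, acgl_perm (sigma j)) /\ s = (\prod_(j < l) sigma j)%g.
    move=> sE; apply: (acgl_factor (H := fun M => M = 1%:M)) l_gt1 _ sE => //.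
    - by move=> M ->; exists 1%:M, 1%:M; rewrite mulmx1.
    - by move=> M ->; exists 1%:M, 1%:M; rewrite mulmx1.
    - by move=> M ->; rewrite unitmx1.
  case: Hg => Eg.
    have [s sE] := lam_permP 0 c1.1; have [sigma [asg Es]] := fac _ _ sE.
    by exists sigma; split => // n; rewrite -Es Eg (CT_id _ sE).
  have [s sE] := lam_permP (const_mx 1) c1.1; have [sigma [asg Es]] := fac _ _ sE.
  exists sigma; split => // n; rewrite -Es Eg (CT_translation _ _ _ sE) //.
  by apply/eqP => /rowP/(_ 0); rewrite !mxE.
have [[Ed Ep]|n22] := eqVneq (d, p) (2, 2)%N.
  subst d p; case=> [|[|]] Eg.
  - have [s sE] := lam_permP 0 (unitmx1 'F_2 2).
    have [sigma [asg Es]] := cyclic3_factor l_gt1 (Or31 _ _ (erefl _)) sE.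
    by exists sigma; split => // n; rewrite -Es Eg (CT_id _ sE).
  - have [s sE] := lam_permP (const_mx 1) (unitmx1 'F_2 2).
    have [sigma [asg Es]] := cyclic3_factor l_gt1 (Or31 _ _ (erefl _)) sE.
    exists sigma; split => // n; rewrite -Es Eg (CT_translation _ _ _ sE) //.
    by apply/eqP => /rowP/(_ 0); rewrite !mxE.
  - have [s sE] := lam_permP 0 complete_w.1.
    have [sigma [asg Es]] := cyclic3_factor l_gt1 (Or32 _ _ (erefl _)) sE.
    by exists sigma; split => // n; rewrite -Es Eg (CT_w sE).
case=> M [v [s [uM [sE CTs]]]].
have av (N : 'M['F_p]_d) : avoidable N by exact: avoidable_Fp.
have [|||sigma [asg Es]] := acgl_factor (H := fun M => M \in unitmx) _ _ _ l_gt1 uM sE.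
- by move=> N; apply: avoidable_factor.
- move=> N uN; have [A [B [cA cB EN]]] := avoidable_factor av uN.
  by exists A, B; split => //; case: cB.
- by [].
by exists sigma; split => // n; rewrite -Es CTs.
Qed.

(** * Coset-wise affine skew products *)

Lemma sum_index_enum (T : finType) (S : {set T}) (F : nat -> nat) :
  (\sum_(x in S) F (index x (enum S)) = \sum_(i < #|S|) F i)%N.
Proof.
have [->|[x0 _]] := set_0Vmem S; first by rewrite big_set0 cards0 big_ord0.
rewrite -big_enum /= (big_nth x0) -cardE big_mkord; apply: eq_bigr => i _.
by rewrite index_uniq ?enum_uniq // -cardE.
Qed.

(** The cycles of each length are numbered from 1 by their position in an enumeration, which matches
    the double indexing by length and number. *)
Lemma sum_porbits_by_size (T : finType) (f : {perm T}) (G : nat -> nat -> nat) :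
  (\sum_(C in porbits f)
      G #|C| (index C (enum [set D in porbits f | #|D| == #|C|])).+1
   = \sum_(1 <= l < #|T|.+1) \sum_(1 <= i < (CT f l).+1) G l i)%N.
Proof.
pose S l := [set D in porbits f | #|D| == l].
transitivity (\sum_(1 <= l < #|T|.+1) \sum_(C in S l) G l (index C (enum (S l))).+1)%N.
  rewrite (exchange_big_dep (mem (porbits f))) /=; last by move=> l C _; rewrite inE => /andP[].
  apply: eq_bigr => C CP.
  rewrite (eq_bigl (pred1 #|C|)) => [|l]; last by rewrite inE CP /= eq_sym.
  rewrite big_mkcond (bigD1_seq #|C|) ?iota_uniq //=.
    by rewrite eqxx big1 ?addn0 // => l /negbTE->.
  case/imsetP: CP => x _ ->; rewrite mem_index_iota card_porbit_gt0 ltnS.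
  exact: max_card.
apply: eq_bigr => l _; rewrite (sum_index_enum (S l) (fun i => G l i.+1)).
by rewrite big_add1 big_mkord.
Qed.

(** The rows of [row_ebase W] form a basis whose first [d] vectors span [W], so [W] is where the
    last [t] coordinates vanish. *)
Lemma rank_coordinates (F : fieldType) d t (W : 'M[F]_(d + t)) : \rank W = d ->
  exists2 Q : 'M[F]_(d + t), Q \in unitmx &
    forall m (x : 'M[F]_(m, d + t)), (x <= W)%MS = (rsubmx (x *m invmx Q) == 0).
Proof.
move=> rkW; exists (row_ebase W); first exact: row_ebase_unit.
move=> m x; rewrite -(eq_row_base W) /row_base.
move: (row_ebase W) (row_ebase_unit W) => Q uQ.
move: (\rank W) rkW => r ->.
rewrite -{1}(mulmxKV uQ x) submxMfree ?row_free_unit //.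
set y := x *m invmx Q; rewrite pid_mx_row.
apply/submxP/eqP => [[z ->]|y0]; first by rewrite mul_mx_row mulmx0 row_mxKr.
by exists (lsubmx y); rewrite mul_mx_row mulmx0 mulmx1 -y0 hsubmxK.
Qed.

Section SkewAffine.
Variables (p d t : nat) (Q : 'M['F_p]_(d + t)).
Hypothesis uQ : Q \in unitmx.
Variables (f : {perm 'rV['F_p]_t}) (phi : 'rV['F_p]_t -> {perm 'rV['F_p]_d}).

Definition glue (xu : 'rV['F_p]_d * 'rV['F_p]_t) := row_mx xu.1 xu.2 *m Q.
Definition unglue (z : 'rV['F_p]_(d + t)) := (lsubmx (z *m invmx Q), rsubmx (z *m invmx Q)).

Lemma glueK : cancel glue unglue.
Proof. by case=> x u; rewrite /unglue /glue mulmxK // row_mxKl row_mxKr. Qed.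

Lemma unglueK : cancel unglue glue.
Proof. by move=> z; rewrite /unglue /glue hsubmxK mulmxKV. Qed.

Lemma glue_bij : bijective glue. Proof. exact: Bijective glueK unglueK. Qed.

Definition skew_fun z := let: (x, u) := unglue z in glue (phi u x, f u).

Lemma skew_fun_inj : injective skew_fun.
Proof.
move=> z z'; rewrite -[z]unglueK -[z']unglueK /skew_fun !glueK.
case: (unglue z) (unglue z') => [x u] [x' u'] /(can_inj glueK)[Ex /perm_inj Eu].
by move: Ex; rewrite Eu => /perm_inj ->.
Qed.

Definition skew_perm := perm skew_fun_inj.

Lemma skew_permE x u : skew_perm (glue (x, u)) = glue (phi u x, f u).
Proof. by rewrite permE /skew_fun glueK. Qed.

(** In coordinates the sum map is (y, v) to (phi_v y + y, f v + v): completeness of [f] recovers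
    [v], then invertibility of [A + 1] recovers [y]. *)
Lemma complete_skew : complete f -> (forall u, acgl_perm (phi u)) -> complete skew_perm.
Proof.
move=> cf aphi; apply: injF_bij => z z'; rewrite -[z]unglueK -[z']unglueK.
case: (unglue z) (unglue z') => [x u] [x' u'].
have addE y v : skew_perm (glue (y, v)) + glue (y, v) = glue (phi v y + y, f v + v).
  by rewrite skew_permE /glue -mulmxDl add_row_mx.
rewrite !addE => /(can_inj glueK)[Ex /(bij_inj cf) Eu].
move: Ex; rewrite -Eu; have [A [v [[_ uA1] phiE]]] := aphi u; rewrite !phiE /lam.
have addA y : y *m A + v + y = y *m (A + 1%:M) + v by rewrite mulmxDr mulmx1 addrAC.
rewrite !addA => /addIr/(congr1 (mulmx^~ (invmx (A + 1%:M)))).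
by rewrite !(mulmxK uA1) => ->.
Qed.

(** On a coset of [W] the coordinate [u] is constant, so the linear part may be [A] on the first
    factor and 0 on the second, with [f u] absorbed into the translation. *)
Lemma coset_affine_skew (W : 'M['F_p]_(d + t)) : (forall u, acgl_perm (phi u)) ->
  (forall m (x : 'M['F_p]_(m, d + t)), (x <= W)%MS = (rsubmx (x *m invmx Q) == 0)) ->
  coset_affine W skew_perm.
Proof.
move=> aphi memW x0; pose u := (unglue x0).2; have [A [v [_ phiE]]] := aphi u.
exists (invmx Q *m block_mx A 0 0 0 *m Q), (glue (v, f u)); split.
  rewrite memW !mulmxA mulmxK // -[W *m _]hsubmxK mul_row_block.
  by rewrite !mulmx0 !addr0 row_mxKr.
move=> x; rewrite memW mulmxBl raddfB subr_eq0 => /eqP Ex.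
have Eu : (unglue x).2 = u by rewrite /u /unglue /= Ex.
rewrite -[x]unglueK (surjective_pairing (unglue x)) Eu skew_permE phiE /lam.
rewrite /glue /= !mulmxA mulmxK // mul_row_block !mulmx0 !addr0 -mulmxDl.
by rewrite add_row_mx add0r.
Qed.
End SkewAffine.

Theorem theorem1p3 (p d t : nat) (k : nat -> nat)
    (gam : nat -> nat -> monomial) :
  prime p -> (0 < d)%N -> (0 < t)%N ->
  (exists f : {perm 'rV['F_p]_t},
      complete f /\ forall l, (0 < l <= p ^ t)%N -> CT f l = k l) ->
  (forall l i, (0 < l <= p ^ t)%N -> (0 < i <= k l)%N -> Gamma d p l (gam l i)) ->
  forall W : 'M['F_p]_(d + t), \rank W = d ->
  exists g : {perm 'rV['F_p]_(d + t)},
    complete g /\ coset_affine W g /\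
    forall n, CT g n =
      (\sum_(1 <= l < (p ^ t).+1) \sum_(1 <= i < (k l).+1) BU l (gam l i) n)%N.
Proof.
move=> p_pr d_gt0 _ [f [cf fk]] HG W rkW.
have cardU : #|{: 'rV['F_p]_t}| = (p ^ t)%N by rewrite card_mx card_Fp // mul1n.
pose idx (C : {set 'rV['F_p]_t}) := (index C (enum [set D in porbits f | #|D| == #|C|])).+1.
have sizeC C : C \in porbits f -> (0 < #|C| <= p ^ t)%N.
  by case/imsetP=> u _ ->; rewrite card_porbit_gt0 -cardU max_card.
have idxP C : C \in porbits f -> (0 < idx C <= k #|C|)%N.
  move=> CP; rewrite -fk ?sizeC // /CT cardE /= index_mem mem_enum inE CP.
  exact: eqxx.
have /fin_all_exists[sigma sigmaP] (C : {set 'rV['F_p]_t}) :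
    exists sg : nat -> {perm 'rV['F_p]_d}, C \in porbits f ->
      (forall j, acgl_perm (sg j)) /\ CT (\prod_(j < #|C|) sg j)%g =1 gam #|C| (idx C).
  have [CP|_] := boolP (C \in porbits f); last by exists (fun=> 1%g).
  have /andP[C_gt0 _] := sizeC C CP.
  have [sg sgP] := Gamma_factor p_pr d_gt0 C_gt0 (HG _ _ (sizeC C CP) (idxP C CP)).
  by exists sg.
(* A base point on each cycle; the default 0 occurs only for empty sets, which are not cycles. *)
pose r (C : {set 'rV['F_p]_t}) := odflt 0 [pick u in C].
have rP C : C \in porbits f -> r C \in C.
  case/imsetP=> u _ ->; rewrite /r; case: pickP => //= /(_ u).
  by rewrite porbit_id.
(* The j-th point of a cycle, counted from its base point, receives the j-th factor, so that the
   return map at the base point is the prescribed product. *)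
pose phi u := sigma (porbit f u) (index u (traject f (r (porbit f u)) #|porbit f u|)).
have aphi u : acgl_perm (phi u).
  by have [|asg _] := sigmaP (porbit f u); [exact: imset_f | exact: asg].
have [Q uQ memW] := rank_coordinates rkW.
exists (skew_perm uQ f phi); split; first exact: complete_skew.
split; first exact: coset_affine_skew.
move=> n; rewrite (CT_skew (glue_bij uQ) (skew_permE uQ f phi) _ rP).
transitivity (\sum_(C in porbits f) BU #|C| (gam #|C| (idx C)) n)%N.
  apply: eq_bigr => C CP; have [u _ EC] := imsetP CP.
  have Er : porbit f (r C) = C by apply/eqP; rewrite [X in _ == X]EC eq_porbit_mem -EC rP.
  have -> : return_perm f phi #|C| (r C) = (\prod_(j < #|C|) sigma C j)%g.
    apply: eq_bigr => j _; rewrite /phi porbit_perm Er permX.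
    rewrite -{1}(nth_traject f (ltn_ord j) (r C)) index_uniq ?size_traject //.
    by rewrite -{2}Er uniq_traject_porbit.
  by have [_ CTs] := sigmaP C CP; rewrite /BU; case: ifP => // _; apply: CTs.
rewrite (sum_porbits_by_size f (fun l i => BU l (gam l i) n)) cardU.
by apply: eq_big_nat => l l_le; rewrite fk.
Qed.
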